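(* Let $d\ge 2$, let $\mathcal{G}=(\mathcal{V},\mathcal{E})$ be an undirected, connected graph with vertex set $\mathcal{V}=\{1,\dots,n\}$, and for each $i\in\mathcal{V}$ let $\mathbf{S}_i\in\mathbb{R}^{d\times d}$ be a (not necessarily symmetric) matrix that is either positive definite or negative definite. Let $\mathbf{x}_i:[0,\infty)\to\mathbb{R}^d$, $i=1,\dots,n$, be the solution, from arbitrary initial states $\mathbf{x}_i(0)\in\mathbb{R}^d$, of $$\dot{\mathbf{x}}_i=\operatorname{sign}(\mathbf{S}_i)\sum_{j\in\mathcal{N}_i}\big(\mathbf{S}_j\mathbf{x}_j-\mathbf{S}_i\mathbf{x}_i\big),\qquad i=1,\dots,n.$$ Define $$\mathbf{x}^a=\Big(\sum_{i=1}^n|\mathbf{S}_i^{-1}|\Big)^{-1}\sum_{i=1}^n\operatorname{sign}(\mathbf{S}_i)\,\mathbf{x}_i(0)\in\mathbb{R}^d .$$ Then, with $\mathbf{x}=[\mathbf{x}_1^\top,\dots,\mathbf{x}_n^\top]^\top$ and $\mathbf{S}=\operatorname{blkdiag}(\mathbf{S}_1,\dots,\mathbf{S}_n)$, $$\mathbf{x}(t)\to\mathbf{S}^{-1}(\mathbf{1}_n\otimes\mathbf{x}^a)\quad\text{as } t\to+\infty,$$ that is, $\mathbf{x}_i(t)\to\mathbf{S}_i^{-1}\mathbf{x}^a$ for every $i$.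
   Context: A real matrix $\mathbf{A}\in\mathbb{R}^{d\times d}$, not necessarily symmetric, is called positive definite (negative definite) if $\mathbf{v}^\top\mathbf{A}\mathbf{v}>0$ (respectively $<0$) for all nonzero $\mathbf{v}\in\mathbb{R}^d$. For such a matrix, $\operatorname{sign}(\mathbf{A})=1$ if $\mathbf{A}$ is positive definite and $\operatorname{sign}(\mathbf{A})=-1$ if it is negative definite, and $|\mathbf{A}|:=\operatorname{sign}(\mathbf{A})\,\mathbf{A}$, which is positive definite. (If $\mathbf{A}$ is positive/negative definite, so is $\mathbf{A}^{-1}$, with the same sign, and $|\mathbf{A}^{-1}|=|\mathbf{A}|^{-1}$.) The graph has no self-loops, and $\mathcal{N}_i=\{j\in\mathcal{V}:(i,j)\in\mathcal{E}\}$ is the neighbor set of $i$. $\mathbf{1}_n\in\mathbb{R}^n$ is the all-ones vector, $\otimes$ the Kronecker product, and $\operatorname{blkdiag}$ the block-diagonal matrix with the given diagonal blocks. *)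

(* Defs.v *)
From HB Require Import structures.
From mathcomp Require Import all_boot all_order all_algebra.
From mathcomp Require Import mxtens.
From mathcomp Require Import all_classical all_reals all_analysis.

Set Implicit Arguments.
Unset Strict Implicit.
Unset Printing Implicit Defensive.

Import Order.TTheory GRing.Theory Num.Theory.
Import numFieldNormedType.Exports.

Local Open Scope classical_set_scope.
Local Open Scope ring_scope.

(* No symmetry of A is required in the next two predicates. *)
Definition posdefmx (R : realType) (d : nat) (A : 'M[R]_d) : Prop :=
  forall v : 'cV[R]_d, v != 0 -> 0 < (v^T *m A *m v) 0 0.

Definition negdefmx (R : realType) (d : nat) (A : 'M[R]_d) : Prop :=
  forall v : 'cV[R]_d, v != 0 -> (v^T *m A *m v) 0 0 < 0.

(* The value 0 is a junk value for matrices that are not definite. *)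
Definition sgmx (R : realType) (d : nat) (A : 'M[R]_d) : R :=
  if `[< posdefmx A >] then 1 else if `[< negdefmx A >] then -1 else 0.

Definition absmx (R : realType) (d : nat) (A : 'M[R]_d) : 'M[R]_d :=
  sgmx A *: A.

(* y has derivative l at t, as a function on [0, +oo[: the difference quotient
   only ranges over increments h with 0 <= h + t, so that this is the one-sided
   derivative at t = 0 and the usual derivative at t > 0, and the values of y at
   negative times are irrelevant. *)
Definition is_derive_ge0 (R : realType) (d : nat)
    (y : R -> 'cV[R]_d) (t : R) (l : 'cV[R]_d) : Prop :=
  h^-1 *: (y (h + t) - y t) @[h --> within [set h | 0 <= h + t] 0^'] --> l.

Definition solution (R : realType) (n d : nat) (e : rel 'I_n)
    (S : 'I_n -> 'M[R]_d) (x : 'I_n -> R -> 'cV[R]_d) : Prop :=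
  forall (i : 'I_n) (t : R), 0 <= t ->
    is_derive_ge0 (x i) t
      (sgmx (S i) *: \sum_(j < n | e i j) (S j *m x j t - S i *m x i t)).

Definition agreement (R : realType) (n d : nat)
    (S : 'I_n -> 'M[R]_d) (x0 : 'I_n -> 'cV[R]_d) : 'cV[R]_d :=
  invmx (\sum_(i < n) absmx (invmx (S i))) *m \sum_(i < n) sgmx (S i) *: x0 i.

Lemma blk_dim (n d : nat) : (n * d = \sum_(i < n) d)%N.
Proof. by rewrite sum_nat_const card_ord. Qed.

(* The Kronecker product, with its dimension cast to the one carried by the
   block constructions \mxcol_(i < n) and \mxdiag_(i < n) with blocks of
   size d. *)
Definition kroncol (R : realType) (n d : nat) (u : 'cV[R]_n) (v : 'cV[R]_d) :
    'cV[R]_(\sum_(i < n) d) :=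
  castmx (blk_dim n d, muln1 1) (u *t v).

(* Main.v *)
(* The outputs y_i = S_i x_i obey dy_i/dt = |S_i| g_i, where g_i is the sum of
   y_j - y_i over the neighbours j of i.  The Dirichlet energy, i.e. the sum of
   |y_i - y_j|^2 over ordered edges, has derivative -4 sum_i g_i^T |S_i| g_i,
   at most -c sum_i |g_i|^2 by positive definiteness; on a connected graph
   sum_i |g_i|^2 dominates the energy, which hence decays exponentially and all
   differences y_i - y_j tend to 0.  Moreover sum_i sign(S_i) x_i =
   sum_i |S_i^-1| y_i is conserved, and this fixes the common limit x^a. *)
Require Import Defs.
From HB Require Import structures.
From mathcomp Require Import all_boot all_order all_algebra.
From mathcomp Require Import mxtens ring lra.
From mathcomp Require Import all_classical all_reals all_analysis.

Set Implicit Arguments.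
Unset Strict Implicit.
Unset Printing Implicit Defensive.

Import Order.TTheory GRing.Theory Num.Theory.
Import numFieldNormedType.Exports.

Local Open Scope classical_set_scope.
Local Open Scope ring_scope.

(** * Graph Laplacian and Dirichlet energy of scalar functions on the vertices *)

Definition diffusion (R : realFieldType) (V : finType) (e : rel V)
    (a : V -> R) (i : V) : R := \sum_(j | e i j) (a j - a i).

Definition dirichlet (R : realFieldType) (V : finType) (e : rel V)
    (a : V -> R) : R := \sum_i \sum_(j | e i j) (a i - a j) ^+ 2.

Section Graph.
Variables (R : realFieldType) (V : finType) (e : rel V).
Hypothesis e_sym : symmetric e.
Implicit Types a b : V -> R.

Lemma sum_edges_swap (F : V -> V -> R) :
  \sum_i \sum_(j | e i j) F i j = \sum_i \sum_(j | e i j) F j i.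
Proof.
rewrite (exchange_big_dep xpredT)//=.
by apply: eq_bigr => i _; apply: eq_bigl => j; rewrite e_sym.
Qed.

(** Summation by parts: splitting [b i - b j] and reversing the edges in the second half, as
    symmetry allows, gives the same sum twice. *)
Lemma green_identity a b :
  \sum_i \sum_(j | e i j) (a i - a j) * (b i - b j) =
  - (2 * \sum_i b i * diffusion e a i).
Proof.
transitivity (\sum_i \sum_(j | e i j) ((a i - a j) * b i) -
              \sum_i \sum_(j | e i j) ((a i - a j) * b j)).
  rewrite -sumrB; apply: eq_bigr => i _; rewrite -sumrB.
  by apply: eq_bigr => j _; rewrite mulrBr.
rewrite [X in _ - X]sum_edges_swap -sumrB mulr_sumr -sumrN.
apply: eq_bigr => i _; rewrite /diffusion !mulr_sumr -sumrB -sumrN.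
by apply: eq_bigr => j _; ring.
Qed.

(** Green's identity tested against the constant 1; this is the source of the conservation law. *)
Lemma sum_diffusion a : \sum_i diffusion e a i = 0.
Proof.
have := green_identity a (fun=> 1).
rewrite big1 => [|i _]; last by apply: big1 => j _; rewrite subrr mulr0.
under eq_bigr do rewrite mul1r.
by move/eqP; rewrite eq_sym oppr_eq0 mulf_eq0 pnatr_eq0 /= => /eqP.
Qed.

Lemma dirichlet_ge0 a : 0 <= dirichlet e a.
Proof. by apply: sumr_ge0 => i _; apply: sumr_ge0 => j _; apply: sqr_ge0. Qed.

Lemma edge_le_dirichlet a i j : e i j -> (a i - a j) ^+ 2 <= dirichlet e a.
Proof.
move=> eij; rewrite /dirichlet (bigD1 i)//= (bigD1 j)//= -addrA lerDl.
apply: addr_ge0; first by apply: sumr_ge0 => k _; apply: sqr_ge0.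
by apply: sumr_ge0 => k _; apply: sumr_ge0 => l _; apply: sqr_ge0.
Qed.

(** Induction along a path: each edge costs at most the energy, and (p + q)^2 <= 2 p^2 + 2 q^2 joins
    it to the rest. The constant depends on the path but not on [a]. *)
Lemma connect_dirichlet i j : connect e i j ->
  exists2 K : R, 0 < K & forall a, (a i - a j) ^+ 2 <= K * dirichlet e a.
Proof.
move=> /connectP[p + ->]; elim: p i => [|k p IH] i /=.
  by exists 1 => // a; rewrite subrr expr0n /= mul1r dirichlet_ge0.
case/andP=> eik /IH[K K0 HK]; exists (2 + 2 * K); first by lra.
move=> a; have := edge_le_dirichlet a eik; have := HK a.
set E := dirichlet _ _; set z := a (last _ _) => h1 h2.
have : (a i - z) ^+ 2 <= 2 * (a i - a k) ^+ 2 + 2 * (a k - z) ^+ 2.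
  have := sqr_ge0 ((a i - a k) - (a k - z)); nra.
move=> h3; nra.
Qed.

Hypothesis e_conn : forall i j, connect e i j.

(** The sum of the constants of all pairs dominates each of them, which makes the bound uniform in
    the pair. *)
Lemma diff_le_dirichlet : exists2 K : R, 0 < K &
  forall a i j, (a i - a j) ^+ 2 <= K * dirichlet e a.
Proof.
have P p : exists2 K : R, 0 < K &
    forall a, (a p.1 - a p.2) ^+ 2 <= K * dirichlet e a.
  exact/connect_dirichlet/e_conn.
pose K p := s2val (cid2 (P p)).
have K0 p : 0 < K p := s2valP (cid2 (P p)).
have S0 (A : pred (V * V)) : 0 <= \sum_(p | A p) K p.
  by apply: sumr_ge0 => p _; exact: ltW.
(* The summand 1 keeps the constant positive when [V] is empty. *)
exists (1 + \sum_p K p); first by have := S0 xpredT; lra.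
move=> a i j; apply: le_trans (s2valP' (cid2 (P (i, j))) a) _ => /=.
apply: ler_wpM2r; first exact: dirichlet_ge0.
by rewrite (bigD1 (i, j))//= addrCA lerDl addr_ge0// S0.
Qed.

(* As the diffusion sums to 0, a may be recentred at any vertex in Green's
   identity; AM-GM then absorbs the recentred a in the energy. *)
Lemma dirichlet_le_diffusion : exists2 M : R, 0 < M &
  forall a, dirichlet e a <= M * \sum_i diffusion e a i ^+ 2.
Proof.
have [K K0 HK] := diff_le_dirichlet.
case: (pickP V) => [i0 _|V0]; last first.
  by exists 1 => // a; rewrite /dirichlet mul1r !big_pred0.
pose N : R := #|V|%:R.
have N0 : 0 < N by rewrite ltr0n; apply/card_gt0P; exists i0.
have KN0 : 0 < K * N by exact: mulr_gt0.
exists (4 * (K * N)); first by lra.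
move=> a; set E := dirichlet e a; set G := \sum_i _ ^+ 2.
have sum_dev : \sum_i (a i - a i0) ^+ 2 <= K * N * E.
  apply: le_trans (ler_sum _ (fun i _ => HK a i i0)) _.
  by rewrite sumr_const -mulr_natr mulrAC.
have EE : E = - (2 * \sum_i (a i - a i0) * diffusion e a i).
  rewrite -(green_identity a (fun i => a i - a i0)); apply: eq_bigr => i _.
  by apply: eq_bigr => j _; ring.
(* With this AM-GM weight the sum of squared deviations, at most [K * N * E], is half of [t * E] and
   can be absorbed on the left. *)
pose t := 2 * (K * N).
have t0 : 0 < t by rewrite /t; lra.
have : t * E <= \sum_i (a i - a i0) ^+ 2 + t ^+ 2 * G.
  rewrite EE mulrN !mulr_sumr -big_split /= -sumrN; apply: ler_sum => i _.
  have := sqr_ge0 ((a i - a i0) + t * diffusion e a i); nra.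
move=> h; have {}h : t * E <= 2 * (t ^+ 2 * G) by rewrite /t in h *; lra.
have : t * E <= t * (2 * t * G) by move: h; lra.
by rewrite ler_pM2l // /t; lra.
Qed.

End Graph.

(** * Definite matrices, their signs and inverses *)

Section Definite.
Variables (R : realType) (d : nat).
Implicit Types (A : 'M[R]_d) (v : 'cV[R]_d).

Lemma posdefmxN A : posdefmx (- A) <-> negdefmx A.
Proof.
have qN v : (v^T *m - A *m v) 0 0 = - (v^T *m A *m v) 0 0.
  by rewrite mulmxN mulNmx mxE.
by split=> h v /h; rewrite qN oppr_gt0.
Qed.

Lemma posdefmx_unit A : posdefmx A -> A \in unitmx.
Proof.
move=> hA; rewrite -row_free_unit -kermx_eq0; apply/rowV0P => v /sub_kermxP vA.
apply/eqP/negP => /negP v0.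
have : v^T != 0 by rewrite -(inj_eq trmx_inj) trmxK trmx0.
by move=> /hA; rewrite trmxK vA mul0mx mxE ltxx.
Qed.

(** Substituting v = A w turns the form of the inverse at v into the form of [A] at w, up to
    transposing a 1x1 matrix. *)
Lemma posdefmx_inv A : posdefmx A -> posdefmx (invmx A).
Proof.
move=> hA v v0; have uA := posdefmx_unit hA.
have w0 : invmx A *m v != 0.
  by apply: contraNneq v0 => h; rewrite -[v](mulKVmx uA) h mulmx0.
suff -> : v^T *m invmx A *m v = ((invmx A *m v)^T *m A *m (invmx A *m v))^T.
  by rewrite mxE; exact: hA.
by rewrite -[in RHS]mulmxA mulKVmx// trmx_mul trmxK mulmxA.
Qed.

(** The index [i0] rules out the empty sum, and its term provides the strict inequality. *)
Lemma posdefmx_sum (I : finType) (B : I -> 'M[R]_d) (i0 : I) :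
  (forall i, posdefmx (B i)) -> posdefmx (\sum_i B i).
Proof.
move=> hB v v0; rewrite mulmx_sumr mulmx_suml summxE (bigD1 i0)//=.
by apply: ltr_pwDl; [exact: hB|apply: sumr_ge0 => i _; exact/ltW/hB].
Qed.

Lemma posdefmx_absmx A : posdefmx A \/ negdefmx A -> posdefmx (absmx A).
Proof.
rewrite /absmx /sgmx; case: asboolP => [pA _|nA [//|]].
  by rewrite scale1r.
by case: asboolP => // mA _; rewrite scaleN1r; apply/posdefmxN.
Qed.

Lemma sgmx_sqr A : posdefmx A \/ negdefmx A -> sgmx A * sgmx A = 1.
Proof.
rewrite /sgmx; case: asboolP => [pA _|nA [//|]]; first by rewrite mulr1.
by case: asboolP => // mA _; rewrite mulrNN mulr1.
Qed.

Lemma sgmx_neq0 A : posdefmx A \/ negdefmx A -> sgmx A != 0.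
Proof.
move=> hA; apply/eqP => s0; have /eqP := sgmx_sqr hA.
by rewrite s0 mul0r eq_sym oner_eq0.
Qed.

Lemma definite_unit A : posdefmx A \/ negdefmx A -> A \in unitmx.
Proof.
move=> hA; have := posdefmx_unit (posdefmx_absmx hA).
by rewrite unitmxZ// unitfE sgmx_neq0.
Qed.

Hypothesis d_gt0 : (0 < d)%N.

(** In dimension 0 both predicates hold vacuously; otherwise the all-ones vector separates them. *)
Lemma posdefmx_not_negdefmx A : posdefmx A -> ~ negdefmx A.
Proof.
move=> hA /(_ (const_mx 1)); have v0 : const_mx 1 != 0 :> 'cV[R]_d.
  by apply/eqP => /matrixP/(_ (Ordinal d_gt0) 0)/eqP; rewrite !mxE oner_eq0.
by move=> /(_ v0); rewrite ltNge ltW// hA.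
Qed.

Lemma sgmx_inv A : posdefmx A \/ negdefmx A -> sgmx (invmx A) = sgmx A.
Proof.
rewrite /sgmx => -[pA|nA]; first by rewrite !asboolT//; exact: posdefmx_inv.
have niA : negdefmx (invmx A).
  apply/posdefmxN.
  move/posdefmxN : nA => /[dup] /posdefmx_unit uA /posdefmx_inv.
  by rewrite -scaleN1r in uA *; rewrite invmxZ// invrN1 scaleN1r.
rewrite !(asboolF (fun p => posdefmx_not_negdefmx p _))//.
by rewrite (asboolT nA) (asboolT niA).
Qed.

Lemma absmx_inv A : posdefmx A \/ negdefmx A ->
  absmx (invmx A) = invmx (absmx A).
Proof.
move=> hA; rewrite /absmx sgmx_inv// invmxZ; last first.
  exact: posdefmx_unit (posdefmx_absmx hA).
congr (_ *: _); apply: (mulfI (sgmx_neq0 hA)).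
by rewrite sgmx_sqr// divff// sgmx_neq0.
Qed.

End Definite.

(** * Limits of finite sums and coercivity of positive definite forms *)

Lemma cvg_sumr (R : realType) (T I : Type) (F : set_system T) (r : seq I)
    (P : pred I) (f : I -> T -> R) (l : I -> R) : Filter F ->
  (forall i, P i -> f i x @[x --> F] --> l i) ->
  \sum_(i <- r | P i) f i x @[x --> F] --> \sum_(i <- r | P i) l i.
Proof. by move=> FF; apply: cvg_big; exact: add_continuous. Qed.

(** The form is continuous, so it attains a positive minimum on the compact unit sphere; homogeneity
    of degree 2 extends the bound to all vectors. *)
Lemma posdefmx_coercive (R : realType) (d : nat) (A : 'M[R]_d) : posdefmx A ->
  exists2 c, 0 < c &
    forall v : 'cV[R]_d, c * \sum_k v k 0 ^+ 2 <= (v^T *m A *m v) 0 0.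
Proof.
move=> hA; pose q (u : 'rV[R]_d) := (u *m A *m u^T) 0 0.
have qE u : q u = \sum_j (\sum_i u 0 i * A i j) * u 0 j.
  by rewrite /q mxE; apply: eq_bigr => j _; rewrite !mxE.
have q_cont : continuous q.
  move=> u; have FF : Filter (nbhs u) := nbhs_filter u.
  rewrite /continuous_at (funext qE : q = _); apply: cvg_sumr => j _.
  apply: cvgM; last exact: coord_continuous.
  apply: cvg_sumr => i _.
  by apply: cvgM; [exact: coord_continuous|exact: cvg_cst].
pose B := [set u : 'rV[R]_d | `|u| = 1].
(* If the sphere is empty, normalization shows that every vector is 0, and any constant works. *)
have [[u0 Bu0]|B0] := pselect (B !=set0); last first.
  exists 1 => // v; suff -> : v = 0.
    by rewrite mulmx0 mxE mul1r big1// => k _; rewrite mxE expr0n.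
  apply/eqP/negP => /negP v0; apply: B0; exists (`|v^T|^-1 *: v^T).
  rewrite /B/= normrZ normfV normr_id mulVf// normr_eq0.
  by rewrite -(inj_eq trmx_inj) trmxK trmx0.
have B_compact : compact B.
  apply: bounded_closed_compact.
    by exists 1; split => // M M1 u /= ->; exact: ltW.
  rewrite (_ : B = (Num.norm : 'rV[R]_d -> R) @^-1` [set 1])//.
  apply: closed_comp; last exact: closed_eq.
  by move=> u _; exact: norm_continuous.
have [|u1 + q_min] := EVT_min_rV _ B_compact (continuous_subspaceT q_cont).
  by exists u0.
rewrite inE /B/= => u1_norm.
have q1 : 0 < q u1.
  rewrite /q -{1}[u1]trmxK; apply: hA; rewrite -(inj_eq trmx_inj) trmxK trmx0.
  by rewrite -normr_eq0 u1_norm oner_eq0.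
have q_ge (u : 'rV[R]_d) : q u1 * `|u| ^+ 2 <= q u.
  have [->|u_neq0] := eqVneq u 0.
    by rewrite normr0 expr0n mulr0 /q mul0mx mul0mx mxE.
  have u_gt0 : 0 < `|u| by rewrite normr_gt0.
  have -> : q u = q (`|u|^-1 *: u) * `|u| ^+ 2.
    rewrite !qE mulr_suml; apply: eq_bigr => j _; rewrite !mxE.
    under [in RHS]eq_bigr do rewrite mxE -mulrA.
    by rewrite -mulr_sumr; field; rewrite gt_eqF.
  rewrite ler_pM2r ?exprn_gt0//; apply: q_min.
  by rewrite inE /B/= normrZ normfV normr_id mulVf// gt_eqF.
(* The norm is the maximum norm, so the sum of the [d] squares is at most [d] times its square;
   [d.+1] is a divisor that is visibly positive. *)
exists (q u1 / d.+1%:R); first by rewrite divr_gt0.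
move=> v; have := q_ge v^T; rewrite /q trmxK; apply: le_trans.
rewrite -mulrA ler_pM2l// ler_pdivrMl//.
apply: (@le_trans _ _ (\sum_(k < d) `|v^T| ^+ 2)).
  apply: ler_sum => k _; rewrite -real_normK ?num_real// ler_sqr ?nnegrE//.
  have <- : v^T 0 k = v k 0 by rewrite mxE.
  rewrite [leRHS]/Num.norm /= mx_normrE.
  by apply/bigmax_geP; right; exists (0, k).
by rewrite sumr_const card_ord -[leLHS]mulr_natl ler_wpM2r// ?sqr_ge0// ler_nat.
Qed.

(** * Scalar derivatives, monotonicity and exponential decay *)

Lemma is_derive_sumr (R : realType) (I : Type) (r : seq I) (P : pred I)
    (f : I -> R -> R) (df : I -> R) (t : R) :
  (forall i, P i -> is_derive t 1 (f i) (df i)) ->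
  is_derive t 1 (fun s => \sum_(i <- r | P i) f i s) (\sum_(i <- r | P i) df i).
Proof.
move=> hf; elim: r => [|i r IHr].
  rewrite big_nil (_ : (fun _ => _) = cst 0); first exact: is_derive_cst.
  by apply/funext => s; rewrite big_nil.
rewrite big_cons; case: ifPn => Pi.
  rewrite (_ : (fun _ => _) = f i + (fun s => \sum_(j <- r | P j) f j s)).
    by apply: is_deriveD; exact: hf.
  by apply/funext => s; rewrite big_cons Pi.
rewrite (_ : (fun _ => _) = (fun s => \sum_(j <- r | P j) f j s))//.
by apply/funext => s; rewrite big_cons (negbTE Pi).
Qed.

Lemma is_derive_mull (R : realType) (c : R) (f : R -> R) (t df : R) :
  is_derive t 1 f df -> is_derive t 1 (fun s => c * f s) (c * df).
Proof. exact: is_deriveZ. Qed.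

Lemma is_derive_nonincreasing (R : realType) (f df : R -> R) (a b : R) :
  (forall t, a <= t -> is_derive t 1 f (df t)) ->
  (forall t, a <= t -> df t <= 0) -> a <= b -> f b <= f a.
Proof.
move=> hf df0 ab.
have cf : {within `[a, b], continuous f}.
  apply: derivable_within_continuous => t; rewrite in_itv /= => /andP[at_ _].
  by case: (hf t at_).
have hf' t : t \in `]a, b[%R -> is_derive t 1 f (df t).
  by rewrite in_itv /= => /andP[/ltW/hf].
have [c + fE] := MVT_segment ab hf' cf.
rewrite in_itv /= => /andP[ac _].
by rewrite -subr_le0 fE mulr_le0_ge0// ?df0// subr_ge0.
Qed.

(** With the integrating factor [expR (c * t)] the product is nonincreasing from time [a] on, so [f]
    is squeezed between 0 and a decaying exponential. *)
Lemma gronwall_cvg0 (R : realType) (f df : R -> R) (c a : R) : 0 < c ->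
  (forall t, a <= t -> is_derive t 1 f (df t)) ->
  (forall t, 0 <= f t) ->
  (forall t, a <= t -> df t <= - (c * f t)) ->
  f t @[t --> +oo] --> 0.
Proof.
move=> c0 hf f0 hdf.
have decay t : a <= t -> f t <= f a * expR (c * a) * expR (- (c * t)).
  move=> at_; rewrite expRN ler_pdivlMr ?expR_gt0//.
  pose g s := f s * expR (c * s).
  pose dg s := f s * (c * expR (c * s)) + expR (c * s) * df s.
  apply: (@is_derive_nonincreasing _ g dg) => // s as_; last first.
    have := hdf s as_; have := expR_gt0 (c * s); rewrite /dg; nra.
  have h1 := hf s as_.
  have h2 : is_derive s 1 (fun s => expR (c * s)) (c * expR (c * s)).
    have -> : (fun s => expR (c * s)) = expR \o (c \*: id) by [].
    by apply: is_derive_eq; rewrite /= /GRing.scale /= mulr1 mulrC.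
  exact: is_deriveM.
apply: (@squeeze_cvgr _ _ _ _ (cst 0)
    (fun t => f a * expR (c * a) * expR (- (c * t)))).
- by near=> t; rewrite f0/=; apply: decay.
- exact: cvg_cst.
- rewrite -(mulr0 (f a * expR (c * a))); apply: cvgMr.
  apply: (@cvg_comp _ _ _ ( *%R c) (fun t => expR (- t)) _ (pinfty_nbhs R)).
    exact: gt0_cvgMry.
  exact: cvgr_expR.
Unshelve. all: by end_near. Qed.

(** * Entrywise convergence of matrices and the derivative on the half-line *)

Lemma cvg_mx (R : realType) (T : Type) (F : set_system T) (m n : nat)
    (f : T -> 'M[R]_(m, n)) (l : 'M[R]_(m, n)) : Filter F ->
  (forall i j, f t i j @[t --> F] --> l i j) -> f t @[t --> F] --> l.
Proof.
move=> FF fl; apply/cvgrPdist_lt => eps eps0; near=> t.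
rewrite [ltLHS]/Num.norm /= mx_normrE; apply/bigmax_ltP; split=> // -[i j] _ /=.
rewrite !mxE; move: i j; near: t.
have : \forall t \near F, forall ij : 'I_m * 'I_n,
    `|l ij.1 ij.2 - f t ij.1 ij.2| < eps.
  apply: filter_forall => -[i j] /=.
  by have /cvgrPdist_lt := fl i j; exact.
by apply: filterS => t h i j; exact: (h (i, j)).
Unshelve. all: by end_near. Qed.

Lemma cvg_coord (R : realType) (T : Type) (F : set_system T) (m n : nat)
    (f : T -> 'M[R]_(m, n)) (l : 'M[R]_(m, n)) i j :
  f t @[t --> F] --> l -> f t i j @[t --> F] --> l i j.
Proof.
by move=> fl; exact: (cvg_comp _ _ fl (@coord_continuous _ _ _ i j l)).
Qed.

Lemma cvg_mulmx (R : realType) (T : Type) (F : set_system T)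
    (m n p : nat) (A : 'M[R]_(m, n)) (f : T -> 'M[R]_(n, p)) l :
  Filter F -> f t @[t --> F] --> l -> A *m f t @[t --> F] --> A *m l.
Proof.
move=> FF fl; apply: cvg_mx => i j; rewrite mxE.
under eq_cvg do rewrite mxE.
by apply: cvg_sumr => k _; apply: cvgM; [exact: cvg_cst|exact: cvg_coord].
Qed.

(** For |h| < t the constraint 0 <= h + t holds automatically, so at positive times the restricted
    quotient has the ordinary two-sided limit. *)
Lemma is_derive_ge0_gt0 (R : realType) (d : nat) (y : R -> 'cV[R]_d) (t : R)
    (l : 'cV[R]_d) (k : 'I_d) : 0 < t -> is_derive_ge0 y t l ->
  is_derive t 1 (fun s => y s k 0) (l k 0).
Proof.
move=> t0 yl; have cvgq : h^-1 *: ((fun s => y s k 0) (h + t) - y t k 0)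
    @[h --> 0^'] --> l k 0.
  have : h^-1 *: (y (h + t) - y t) @[h --> 0^'] --> l.
    apply: cvg_trans yl; apply: cvg_fmap2 => B; rewrite /within/= => hB.
    near=> h; have : 0 <= h + t.
      have : `|h| < t by near: h; exact: dnbhs0_lt.
      by rewrite ltr_norml => /andP[? _]; rewrite -lerBlDr sub0r ltW.
    by near: h.
  by move/(cvg_coord (i := k) (j := 0)); under eq_cvg do rewrite !mxE.
have E : (fun h =>
    h^-1 *: (((fun s => y s k 0) \o shift t) (h *: 1) - y t k 0)) =
    (fun h => h^-1 *: ((fun s => y s k 0) (h + t) - y t k 0)).
  by apply/funext => h /=; rewrite /GRing.scale /= mulr1.
split; first by rewrite /derivable E; apply/cvg_ex; exists (l k 0).
by rewrite /derive E; apply/cvg_lim.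
Unshelve. all: by end_near. Qed.

(** Continuity from differentiability: h times the convergent difference quotient tends to 0. This
    links positive times to the initial state. *)
Lemma is_derive_ge0_cvg_right (R : realType) (d : nat) (y : R -> 'cV[R]_d)
    (l : 'cV[R]_d) (k : 'I_d) : is_derive_ge0 y 0 l ->
  y h k 0 @[h --> 0^'+] --> y 0 k 0.
Proof.
move=> yl.
have : h^-1 *: (y (h + 0) - y 0) @[h --> 0^'+] --> l.
  apply: cvg_trans yl; apply: cvg_fmap2 => B hB.
  have {}hB : \forall h \near (0 : R), h != 0 -> 0 <= h + 0 -> B h by exact: hB.
  apply: (filterS _ hB : \forall h \near (0 : R), 0 < h -> B h) => h hBh h0.
  by apply: hBh; [rewrite gt_eqF|rewrite addr0 ltW].
move/(cvg_coord (i := k) (j := 0)) => hl.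
have hid : h @[h --> 0^'+] --> (0 : R) by exact: cvg_within.
have ylim : h * (h^-1 *: (y (h + 0) - y 0)) k 0 + y 0 k 0 @[h --> 0^'+] -->
    y 0 k 0.
  rewrite -[X in _ --> X]add0r -[X in _ --> X + _](mul0r (l k 0)).
  by apply: cvgD; [exact: cvgM|exact: cvg_cst].
apply: cvg_trans ylim; apply: near_eq_cvg.
by near=> h; rewrite !mxE addr0 mulrA divff ?mul1r ?subrK//.
Unshelve. all: by end_near. Qed.

(** * Kronecker products and block-diagonal inverses *)

Lemma kroncol1 (R : realType) (n d : nat) (v : 'cV[R]_d) :
  kroncol (const_mx 1 : 'cV_n) v = \mxcol_(i < n) v.
Proof.
apply/mxcolP => i; rewrite mxcolK; apply/matrixP => k j; rewrite !mxE castmxE.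
rewrite mxE mxE mul1r ord1; congr (v _ _); last by rewrite ord1.
(* Entry [k] of block [i] has global index i d + k, and the Kronecker product reads its second
   factor at the residue of this index modulo d. *)
apply: val_inj; transitivity (@tagnat.Rank n (fun=> d) i k %% d)%N => //.
by rewrite tagnat.RankEsum sum_nat_cond_const modnMDl modn_small.
Qed.

Lemma mxdiag_inv_mxcol (R : realType) (n d m : nat) (B : 'I_n -> 'M[R]_d)
    (C : 'I_n -> 'M[R]_(d, m)) : (forall i, B i \in unitmx) ->
  invmx (\mxdiag_(i < n) B i) *m (\mxcol_(i < n) C i) =
  \mxcol_(i < n) (invmx (B i) *m C i).
Proof.
move=> uB; have uD : \mxdiag_(i < n) B i \in unitmx.
  rewrite -row_free_unit; apply/row_freeP.
  (* The blockwise inverse is a right inverse, which for a square matrix gives invertibility. *)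
  exists (\mxdiag_(i < n) invmx (B i)).
  rewrite [X in _ *m X]/mxdiag mul_mxdiag_mxblock -(mxdiagZ 1).
  apply: eq_mxblock => i j; case: eqVneq => [_|_]; last by rewrite mulmx0.
  by rewrite !conform_mx_id mulmxV.
rewrite -[RHS](mulKmx uD) mul_mxdiag_mxcol; congr (_ *m _).
by apply: eq_mxcol => i; rewrite mulKVmx.
Qed.

(** * Conservation, energy decay and consensus of the outputs *)

Section Consensus.
Variables (R : realType) (n d : nat) (e : rel 'I_n).
Variables (S : 'I_n -> 'M[R]_d) (x : 'I_n -> R -> 'cV[R]_d).
Hypothesis e_sym : symmetric e.
Hypothesis e_conn : forall i j, connect e i j.
Hypothesis S_def : forall i, posdefmx (S i) \/ negdefmx (S i).
Hypothesis x_sol : solution e S x.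

Implicit Types (i j : 'I_n) (k : 'I_d) (t : R).

(** The vertex comes last, so that [y t k] is a scalar function on the graph, to which the graph
    lemmas apply. *)
Let y (t : R) (k : 'I_d) (i : 'I_n) : R := (S i *m x i t) k 0.

Lemma is_derive_state i k t : 0 < t ->
  is_derive t 1 (fun s => x i s k 0) (sgmx (S i) * diffusion e (y t k) i).
Proof.
move=> t0; apply: is_derive_eq (is_derive_ge0_gt0 k t0 (@x_sol i t (ltW t0))) _.
by rewrite mxE summxE; congr (_ * _); apply: eq_bigr => j _; rewrite /y !mxE.
Qed.

Lemma is_derive_output i k t : 0 < t ->
  is_derive t 1 (fun s => y s k i)
    ((absmx (S i) *m \col_l diffusion e (y t l) i) k 0).
Proof.
move=> t0; rewrite (_ : (fun _ => _) = fun s => \sum_l S i k l * x i s l 0).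
  rewrite mxE; apply: is_derive_sumr => l _; rewrite !mxE -mulrA mulrCA.
  exact/is_derive_mull/is_derive_state.
by apply/funext => s; rewrite /y mxE.
Qed.

(** The signs square to 1, so the derivative is the total diffusion, which is 0. This makes the sum
    constant on positive times only; right continuity at 0 identifies the constant with the initial
    value. *)
Lemma sum_state_conserved t k : 0 < t ->
  \sum_i sgmx (S i) * x i t k 0 = \sum_i sgmx (S i) * x i 0 k 0.
Proof.
move=> t0; pose m s := \sum_i sgmx (S i) * x i s k 0.
have dm (s : R) : 0 < s -> is_derive s 1 m 0.
  move=> s0; rewrite -(sum_diffusion e_sym (y s k)).
  apply: is_derive_sumr => i _.
  have := is_derive_mull (sgmx (S i)) (is_derive_state i k s0).
  by rewrite mulrA sgmx_sqr// mul1r.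
have m_cst (s s' : R) : 0 < s -> s <= s' -> m s' = m s.
  move=> s0 ss'; have pos r : s <= r -> 0 < r by exact: lt_le_trans.
  apply/eqP; rewrite eq_le; apply/andP; split.
    by apply: (@is_derive_nonincreasing _ m (fun=> 0)) => // r /pos/dm.
  rewrite -lerN2.
  apply: (@is_derive_nonincreasing _ (- m) (fun=> 0)) => // r /pos/dm h.
  by rewrite -oppr0; exact: is_deriveN.
have m_lim : m h @[h --> 0^'+] --> m 0.
  apply: cvg_sumr => i _; apply: cvgM; first exact: cvg_cst.
  exact: is_derive_ge0_cvg_right (@x_sol i 0 (lexx 0)).
have m_lim' : m h @[h --> 0^'+] --> m t.
  apply: (cvg_trans (near_eq_cvg _)); last exact: cvg_cst.
  near=> h; apply: m_cst; first by near: h; exact: nbhs_right_gt.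
  by near: h; exact: nbhs_right_le.
exact: cvg_unique m_lim' m_lim.
Unshelve. all: by end_near. Qed.

(** The matrices [absmx (S i)] mix coordinates, so dissipation is established for the energy summed
    over all [k]. *)
Let energy (t : R) : R := \sum_k dirichlet e (y t k).

Lemma dirichlet_cvg0 : energy t @[t --> +oo] --> (0 : R).
Proof.
have [c c0 c_le] : exists2 c : R, 0 < c & forall i (v : 'cV[R]_d),
    c * \sum_k v k 0 ^+ 2 <= (v^T *m absmx (S i) *m v) 0 0.
  pose C i := posdefmx_coercive (posdefmx_absmx (S_def i)).
  pose c i := s2val (cid2 (C i)).
  have c0 i : 0 < c i := s2valP (cid2 (C i)).
  (* The minimum over finitely many agents is a common coercivity constant; the default 1 keeps it
     positive when [n] is 0. *)
  exists (\big[Order.min/1]_i c i).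
    by apply/bigmin_gtP; split=> // i _; exact: c0.
  move=> i v; apply: le_trans (s2valP' (cid2 (C i)) v).
  apply: ler_wpM2r; last exact: bigmin_le_cond.
  by apply: sumr_ge0 => k _; exact: sqr_ge0.
have [M M0 HM] := dirichlet_le_diffusion R e_sym e_conn.
pose g t i : 'cV[R]_d := \col_l diffusion e (y t l) i.
pose dy t k i := (absmx (S i) *m g t i) k 0.
pose dV t := \sum_k \sum_i \sum_(j | e i j)
  2 * (y t k i - y t k j) * (dy t k i - dy t k j).
(* Starting at time 1 avoids the one-sided derivative at 0. *)
apply: (@gronwall_cvg0 _ _ dV (4 * c / M) 1).
- by rewrite divr_gt0// mulr_gt0.
- move=> t t1; have t0 : 0 < t by exact: lt_le_trans t1.
  apply: is_derive_sumr => k _; apply: is_derive_sumr => i _.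
  apply: is_derive_sumr => j _.
  have hi := is_derive_output i k t0; have hj := is_derive_output j k t0.
  have := is_deriveX 2 (is_deriveB hi hj).
  by rewrite expr1.
- by move=> t; apply: sumr_ge0 => k _; exact: dirichlet_ge0.
- move=> t _.
  (* Green's identity in each coordinate, tested against [dy t k]: one factor 2 comes from
     differentiating the square, the other from the identity. *)
  have dVE : dV t = - (4 * \sum_i ((g t i)^T *m absmx (S i) *m g t i) 0 0).
    transitivity (\sum_k - (4 * \sum_i dy t k i * diffusion e (y t k) i)).
      apply: eq_bigr => k _.
      rewrite (_ : 4 = 2 * 2 :> R); last by ring.
      rewrite -mulrA -mulrN -green_identity// mulr_sumr; apply: eq_bigr => i _.
      by rewrite mulr_sumr; apply: eq_bigr => j _; rewrite mulrA.
    rewrite sumrN -mulr_sumr exchange_big /=; congr (- (_ * _)).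
    apply: eq_bigr => i _; rewrite -mulmxA mxE; apply: eq_bigr => k _.
    by rewrite 2!mxE mulrC.
  rewrite dVE lerN2 -!mulrA ler_pM2l//.
  (* Coercivity bounds the dissipation below by [c] times the squared diffusions, and these bound
     the energy up to the factor [M] in each coordinate; hence the rate [4 * c / M]. *)
  apply: le_trans (ler_sum _ (fun i _ => c_le i (g t i))).
  rewrite -mulr_sumr ler_pM2l// ler_pdivrMl// [in leRHS]exchange_big mulr_sumr.
  apply: ler_sum => k _; apply: le_trans (HM _) _; rewrite ler_pM2l//.
  by apply: ler_sum => i _; rewrite mxE.
Qed.

Lemma output_consensus i j :
  S i *m x i t - S j *m x j t @[t --> +oo] --> (0 : 'cV[R]_d).
Proof.
have [K K0 HK] := diff_le_dirichlet R e_conn.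
apply: cvg_mx => k z; rewrite ord1 [X in _ --> X]mxE.
have -> : (fun t => (S i *m x i t - S j *m x j t) k 0) =
    (fun t => y t k i - y t k j) by apply/funext => t; rewrite /y !mxE.
have sq : (y t k i - y t k j) ^+ 2 @[t --> +oo] --> (0 : R).
  apply: (@squeeze_cvgr _ _ _ _ (cst 0)
      (fun t => K * energy t)).
  - near=> t; rewrite sqr_ge0/=; apply: le_trans (HK _ _ _) _.
    rewrite ler_pM2l// /energy (bigD1 k)//= lerDl; apply: sumr_ge0 => l _.
    exact: dirichlet_ge0.
  - exact: cvg_cst.
  - by rewrite -[X in _ --> X](mulr0 K); apply: cvgMr; exact: dirichlet_cvg0.
(* The energy controls only the square; the square root recovers the absolute value of the
   difference. *)
have : Num.sqrt ((y t k i - y t k j) ^+ 2) @[t --> +oo] --> Num.sqrt 0.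
  by apply: continuous_cvg => //; exact: sqrt_continuous.
rewrite sqrtr0; under eq_cvg do rewrite sqrtr_sqr.
exact: norm_cvg0.
Unshelve. all: by end_near. Qed.

End Consensus.

(** * Identification of the limit *)

Theorem theorem1 (R : realType) (n d : nat) (e : rel 'I_n)
    (S : 'I_n -> 'M[R]_d) (x : 'I_n -> R -> 'cV[R]_d)
    (d_ge2 : (2 <= d)%N)
    (e_sym : symmetric e)
    (e_irr : irreflexive e)
    (e_conn : forall i j : 'I_n, connect e i j)
    (S_def : forall i : 'I_n, posdefmx (S i) \/ negdefmx (S i))
    (x_sol : solution e S x) :
  let xa := agreement S (fun i => x i 0) in
  ((\mxcol_(i < n) x i t) @[t --> +oo] -->
     invmx (\mxdiag_(i < n) S i) *m kroncol (const_mx 1) xa)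
  /\ (forall i : 'I_n, x i t @[t --> +oo] --> invmx (S i) *m xa).
Proof.
move=> xa; have d0 : (0 < d)%N by exact: ltnW.
have x_cvg i : x i t @[t --> +oo] --> invmx (S i) *m xa.
  pose A j := absmx (invmx (S j)); pose Q := \sum_j A j.
  pose b := \sum_j sgmx (S j) *: x j 0.
  pose r t j := A j *m (S i *m x i t - S j *m x j t).
  have uS j : S j \in unitmx by exact: definite_unit.
  have uQ : Q \in unitmx.
    apply/posdefmx_unit/(posdefmx_sum i) => j.
    by rewrite /A absmx_inv//; exact/posdefmx_inv/posdefmx_absmx.
  (* As [A j *m S j] is the sign of [S j] times the identity, conservation says that the sum of
     [A j *m (S j *m x j t)] is [b]. Replacing every output by that of agent [i] costs exactly the
     errors [r t j], and the resulting equation is solved for [x i t]. *)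
  have xE t : 0 < t ->
      x i t = invmx (S i) *m (invmx Q *m (b + \sum_j r t j)).
    move=> t0; have bE : b = \sum_j sgmx (S j) *: x j t.
      apply/matrixP => k z; rewrite ord1 /b !summxE.
      under eq_bigr do rewrite mxE.
      rewrite -(sum_state_conserved e_sym S_def x_sol k t0).
      by apply: eq_bigr => j _; rewrite mxE.
    have -> : \sum_j r t j = Q *m (S i *m x i t) - b.
      rewrite bE mulmx_suml -sumrB; apply: eq_bigr => j _.
      rewrite /r mulmxBr; congr (_ - _).
      by rewrite /A /absmx sgmx_inv// -scalemxAl mulKmx.
    by rewrite addrC subrK mulKmx// mulKmx.
  have r_cvg : \sum_j r t j @[t --> +oo] --> \sum_j A j *m (0 : 'cV[R]_d).
    apply: cvg_big => [|j _]; first exact: add_continuous.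
    by apply: cvg_mulmx; exact: output_consensus.
  have : invmx (S i) *m (invmx Q *m (b + \sum_j r t j)) @[t --> +oo] -->
      invmx (S i) *m (invmx Q *m (b + \sum_j A j *m (0 : 'cV[R]_d))).
    by do 2 apply: cvg_mulmx; apply: cvgD; first exact: cvg_cst.
  (* The errors vanish in the limit, leaving the agreement vector; the formula for [x i t] holds at
     positive times, hence eventually. *)
  rewrite -mulmx_suml mulmx0 addr0; apply: cvg_trans; apply: near_eq_cvg.
  by near=> t; rewrite -xE.
split=> //; rewrite kroncol1 mxdiag_inv_mxcol; last first.
  by move=> i; exact: definite_unit.
apply: cvg_mx => s z; rewrite mxE.
under eq_cvg do rewrite mxE.
exact: cvg_coord.
Unshelve. all: by end_near. Qed.
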